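(* Let $p$ be a real polynomial having only real zeros and suppose $M(p)\ge 1$. Then for any function $\mu:\mathbb{R}\to[0,\infty)$ and every real $x$, $$p^2(x)-p(x-1)p(x+1)+\frac14\Bigl(p(x+1)-\mu(x)\,p(x)+p(x-1)\Bigr)^2\ \ge 0 .$$
   Context: For a real polynomial $p$ having only real zeros, the mesh $M(p)$ is the infimum of the distances between consecutive zeros of $p$, the zeros being listed in nondecreasing order with multiplicity (so a multiple zero forces $M(p)=0$); if $p$ has at most one zero, $M(p)=+\infty$. *)

(* Defs.v *)
From HB Require Import structures.
From mathcomp Require Import all_boot all_order all_algebra.
From mathcomp Require Import classical_sets reals ereal.
From mathcomp Require Import complex polyrcf.

Set Implicit Arguments.
Unset Strict Implicit.
Unset Printing Implicit Defensive.

Import Order.TTheory GRing.Theory Num.Theory.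

Local Open Scope ring_scope.
Local Open Scope classical_set_scope.

(* The zero polynomial is not real-rooted, since it vanishes at 'i. *)
Definition real_rooted (R : realType) (p : {poly R}) : Prop :=
  forall z : R[i], root (map_poly (real_complex R) p) z -> complex.Im z = 0.

(* [rootsR p] is strictly increasing, so this list is nondecreasing: see
   [zeros_sorted], [mem_zeros] and [count_zeros]. *)
Definition zeros (R : realType) (p : {poly R}) : seq R :=
  flatten [seq nseq (mup a p) a | a <- rootsR p].

(* With at most one zero the set of gaps is empty, and its infimum in
   [\bar R] is [+oo]. *)
Definition mesh (R : realType) (p : {poly R}) : \bar R :=
  ereal_inf [set ((zeros p)`_i.+1 - (zeros p)`_i)%:E |
             i in [set i : nat | (i.+1 < size (zeros p))%N]].

Lemma mem_zeros (R : realType) (p : {poly R}) (x : R) :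
  p != 0 -> (x \in zeros p) = root p x.
Proof.
move=> p0; have := roots_on_rootsR p0 x; rewrite in_itv /= => rE.
apply/flatten_mapP/idP => [[a ap]|rx].
  rewrite mem_nseq => /andP[_ /eqP->].
  by have := roots_on_rootsR p0 a; rewrite ap in_itv.
exists x; first by rewrite -rE.
by rewrite mem_nseq eqxx andbT -XsubC_dvd // dvdp_XsubCl.
Qed.

Lemma count_zeros (R : realType) (p : {poly R}) (x : R) :
  p != 0 -> count_mem x (zeros p) = mup x p.
Proof.
move=> p0; rewrite /zeros count_flatten -map_comp.
have -> : [seq (count_mem x \o (fun a => nseq (mup a p) a)) a | a <- rootsR p]
        = [seq (a == x) * mup x p | a <- rootsR p]%N.
  by apply: eq_map => a /=; rewrite count_nseq /=; case: eqP => [->|].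
have -> : sumn [seq ((a == x) * mup x p)%N | a <- rootsR p]
        = (count_mem x (rootsR p) * mup x p)%N.
  by elim: (rootsR p) => //= a s ->; rewrite mulnDl.
have := roots_on_rootsR p0 x; rewrite in_itv /= => rE.
rewrite count_uniq_mem ?uniq_roots // -rE.
by case: (boolP (root p x)) => [_|/mupNroot ->]; rewrite ?mul1n.
Qed.

Lemma zeros_sorted (R : realType) (p : {poly R}) : sorted <=%R (zeros p).
Proof.
rewrite sorted_pairwise; last exact: le_trans.
rewrite /zeros; have := sorted_roots (- cauchy_bound p) (cauchy_bound p) p.
rewrite -/(rootsR p) lt_sorted_pairwise.
elim: (rootsR p) => //= a s IHs /andP[/allP alts /IHs sE].
rewrite pairwise_cat sE andbT; apply/andP; split.
  apply/allrelP => x y; rewrite mem_nseq => /andP[_ /eqP->].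
  case/flatten_mapP=> b /alts /ltW ab.
  by rewrite mem_nseq => /andP[_ /eqP->].
elim: (mup a p) => //= n ->; rewrite andbT.
by apply/allP => y; rewrite mem_nseq => /andP[_ /eqP->].
Qed.

(* Main.v *)
Require Import Defs.
From mathcomp Require Import all_boot all_order all_algebra.
From mathcomp Require Import reals ereal.
From mathcomp Require Import classical_sets complex polyrcf lra.

(** Write A = p(x), B = p(x + 1), C = p(x - 1) and m = mu x. If B C <= 0, then
    the expression is a sum of nonnegative terms. If A (B + C) <= 0, it equals
    (1 + m ^ 2 / 4) A ^ 2 - m A (B + C) / 2 + (B - C) ^ 2 / 4, nonnegative
    because m >= 0. In the remaining case A, B and C are nonzero and have the
    same sign.

    The zeros of p are simple and at distance at least 1 from each other, so a
    closed interval of length 1 that contains a zero has no other zero in its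
    interior, and the values of p at its ends cannot have the same strict sign
    ([horner_zero_in_unit_itv]). In the remaining case, therefore, every zero
    is at distance at least 1 from x. Each linear factor then satisfies
    0 <= (x - 1 - a) (x + 1 - a) <= (x - a) ^ 2, and the product of these
    inequalities over the zeros is B C <= A ^ 2 ([turan_zero_free]).

    Both arguments need p to be a product of linear factors over R, indexed by
    the list of its zeros ([real_rooted_factor]). *)

Import Order.TTheory GRing.Theory Num.Theory.

Local Open Scope ring_scope.

(** The splitting of p over the algebraically closed field R[i] descends to R
    because its roots are real; multiplicities then identify the roots of this
    splitting with [zeros p], up to order. *)
Lemma real_rooted_factor (R : realType) (p : {poly R}) :
  real_rooted p -> p = lead_coef p *: \prod_(a <- zeros p) ('X - a%:P).
Proof.
move=> p_real; have [->|p0] := eqVneq p 0; first by rewrite lead_coef0 scale0r.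
have [s sE] := closed_field_poly_normal (map_poly (real_complex R) p).
have s_real z : z \in s -> z = real_complex R (complex.Re z).
  move=> zs; have : root (map_poly (real_complex R) p) z.
    rewrite sE rootZ ?root_prod_XsubC //.
    by rewrite lead_coef_eq0 map_poly_eq0.
  by move=> /p_real; case: z {zs} => a b /= ->.
have pE : p = lead_coef p *: \prod_(a <- map (@complex.Re R) s) ('X - a%:P).
  apply: (map_poly_inj (real_complex R)).
  rewrite {1}sE lead_coef_map map_polyZ rmorph_prod big_map.
  congr (_ *: _); apply: eq_big_seq => z /s_real {1}->.
  by rewrite rmorphB /= map_polyX map_polyC.
rewrite {1}pE; congr (_ *: _); apply: perm_big.
apply/allP => a _; apply/eqP; rewrite /= count_zeros // pE.
rewrite -mul_polyC mupMr ?mu_prod_XsubC //.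
by rewrite rootE hornerC lead_coef_eq0.
Qed.

Lemma real_rooted_horner (R : realType) (p : {poly R}) (y : R) :
  real_rooted p -> p.[y] = lead_coef p * \prod_(a <- zeros p) (y - a).
Proof.
move=> /real_rooted_factor {1}->; rewrite hornerZ horner_prod.
by congr (_ * _); apply: eq_bigr => a _; rewrite hornerXsubC.
Qed.

Lemma mesh_ge1_pairwise (R : realType) (p : {poly R}) :
  (1 <= mesh p)%E -> pairwise (fun a b => a + 1 <= b) (zeros p).
Proof.
move=> p_mesh; rewrite -sorted_pairwise; last by move=> b a c ab bc; lra.
apply/(sortedP 0) => i ltis.
have : (1 <= ((zeros p)`_i.+1 - (zeros p)`_i)%:E)%E.
  by apply: (le_trans p_mesh); apply: ereal_inf_lbound; exists i.
by rewrite lee_fin => ?; lra.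
Qed.

(** The pair of linear factors of the zero a has a nonpositive product, and
    every other zero lies weakly outside the interval. *)
Lemma horner_zero_in_unit_itv (R : realFieldType) (s : seq R) (a y : R) :
  pairwise (fun a b => a + 1 <= b) s -> a \in s -> y <= a <= y + 1 ->
  (\prod_(b <- s) (y - b)) * (\prod_(b <- s) (y + 1 - b)) <= 0.
Proof.
move=> s_sep a_s /andP[ya ay]; rewrite -big_split /=.
have s_uniq : uniq s.
  by apply: (pairwise_uniq _ s_sep) => b /=; apply/negbTE; rewrite -ltNge; lra.
rewrite (bigD1_seq a) //= mulr_le0_ge0 //; first by nra.
rewrite big_seq_cond; apply: prodr_ge0 => b /andP[b_s ba].
have sepP i j : (i < j < size s)%N -> s`_i + 1 <= s`_j.
  case/andP=> ij js; apply: (pairwiseP 0 s_sep) => //.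
  by rewrite inE (ltn_trans ij).
have : a + 1 <= b \/ b + 1 <= a.
  rewrite -(nth_index 0 a_s) -(nth_index 0 b_s).
  case: (ltngtP (index a s) (index b s)) => [lt|lt|E].
  - by left; apply: sepP; rewrite lt index_mem.
  - by right; apply: sepP; rewrite lt index_mem.
  - by case/eqP: ba; rewrite -(nth_index 0 b_s) -E nth_index.
by case=> ?; [apply: mulr_le0|apply: mulr_ge0]; lra.
Qed.

(** With every a at distance at least 1 from x, the two linear factors of a on
    the left multiply to (x - a) ^ 2 - 1 >= 0, so these inequalities between
    factors may be multiplied together. *)
Lemma turan_zero_free (R : realFieldType) (s : seq R) (x : R) :
  (forall a, a \in s -> a <= x - 1 \/ x + 1 <= a) ->
  (\prod_(a <- s) (x - 1 - a)) * (\prod_(a <- s) (x + 1 - a))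
    <= (\prod_(a <- s) (x - a)) ^+ 2.
Proof.
move=> s_out; rewrite -big_split -prodrXl /= big_seq [leRHS]big_seq.
by apply: ler_prod => a /s_out []; nra.
Qed.

Theorem theorem3 (R : realType) (p : {poly R})
    (p_real : real_rooted p) (p_mesh : (1 <= mesh p)%E)
    (mu : R -> R) (mu_ge0 : forall y : R, 0 <= mu y) (x : R) :
  p.[x] ^+ 2 - p.[x - 1] * p.[x + 1]
    + 4^-1 * (p.[x + 1] - mu x * p.[x] + p.[x - 1]) ^+ 2 >= 0.
Proof.
move: p_mesh => /mesh_ge1_pairwise s_sep.
have turan_suffices : p.[x - 1] * p.[x + 1] <= p.[x] ^+ 2 ->
    p.[x] ^+ 2 - p.[x - 1] * p.[x + 1]
      + 4^-1 * (p.[x + 1] - mu x * p.[x] + p.[x - 1]) ^+ 2 >= 0.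
  by move=> ?; rewrite addr_ge0 ?subr_ge0 // mulr_ge0 ?invr_ge0 ?sqr_ge0.
have [BC|BC] := leP (p.[x - 1] * p.[x + 1]) 0.
  by apply: turan_suffices; apply: le_trans BC (sqr_ge0 _).
have [AS|AS] := leP (p.[x] * (p.[x + 1] + p.[x - 1])) 0.
  (* The summands of the expansion of the goal as a quadratic in mu x. *)
  have := mulr_ge0_le0 (mu_ge0 x) AS.
  have := sqr_ge0 p.[x]; have := sqr_ge0 (mu x * p.[x]).
  by have := sqr_ge0 (p.[x + 1] - p.[x - 1]); nra.
have AA : 0 < p.[x] ^+ 2.
  by rewrite exprn_even_gt0 //=; apply: contraTneq AS => ->; rewrite mul0r ltxx.
(* A B and A C have a positive sum and a positive product, A ^ 2 B C. *)
have ABC := mulr_gt0 AA BC.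
have AC : 0 < p.[x - 1] * p.[x] by rewrite ltNge; apply/negP => ?; nra.
have AB : 0 < p.[x] * p.[x + 1] by rewrite ltNge; apply/negP => ?; nra.
apply: turan_suffices; move: AC AB; rewrite !real_rooted_horner // => AC AB.
have := sqr_ge0 (lead_coef p).
move: AC AB; set c := lead_coef p => AC AB cc.
rewrite mulrACA exprMn -expr2 ler_wpM2l //.
apply: turan_zero_free => a a_s.
have [?|xa] := leP a (x - 1); first by left.
have [?|ax] := leP (x + 1) a; first by right.
exfalso; have [ax'|xa'] := leP a x.
  have itv : x - 1 <= a <= x - 1 + 1 by apply/andP; split; lra.
  have := horner_zero_in_unit_itv _ _ _ _ s_sep a_s itv.
  rewrite subrK => le0; move: AC; rewrite mulrACA -expr2.
  by rewrite ltNge mulr_ge0_le0.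
have itv : x <= a <= x + 1 by apply/andP; split; lra.
have := horner_zero_in_unit_itv _ _ _ _ s_sep a_s itv.
by move=> le0; move: AB; rewrite mulrACA -expr2 ltNge mulr_ge0_le0.
Qed.
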